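(* Let $\ell$ be an odd prime. Then every prime $p$ dividing $2^\ell-1$ satisfies $d_p=\ell$ and $p\equiv1\pmod{2\ell}$; moreover $\Delta_\ell=\Omega_\ell$, and $D(\mathcal{W}(\ell))=\ell$ whenever $\mathcal{W}(\ell)\ne\varnothing$. Define $\rho_{\mathcal{W}}^{\mathrm{pr}}=\limsup_{\ell\to\infty}\Omega_\ell/(\ell\log2)$, where $\ell$ runs through the odd primes. Then, for every fixed $\varepsilon>0$, the prime-exponent family $(\mathcal{V}_\ell)$ contains infinitely many triples with $E_\varepsilon(\mathcal{V}_\ell)\ge0$ precisely when infinitely many primes $\ell$ satisfy $$B(\mathcal{W}(\ell))\ \ge\ 2(1-2^{-\ell})\,2^{\theta_\varepsilon\ell},\qquad \theta_\varepsilon=\frac{\varepsilon}{1+\varepsilon},$$ and an $\varepsilon>0$ for which this occurs exists precisely when $\rho_{\mathcal{W}}^{\mathrm{pr}}>0$.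
   Context: For $m\ge2$, $\mathcal{V}_m=(1,2^m-1,2^m)$. For a triple $(a,b,c)$ of positive integers with $a+b=c$, $E_\varepsilon(a,b,c)=\log c-(1+\varepsilon)\log\mathrm{rad}(abc)$, where $\mathrm{rad}(n)$ is the product of the distinct primes dividing $n$. Put $\Delta_m=\log\bigl((2^m-1)/\mathrm{rad}(2^m-1)\bigr)$. For an odd prime $p$, let $d_p$ be the multiplicative order of $2$ modulo $p$ and $A_p=v_p(2^{d_p}-1)$, with $v_p$ the $p$-adic valuation. $\mathcal{W}$ is the set of Wieferich primes, i.e. odd primes $p$ with $2^{p-1}\equiv1\pmod{p^2}$, and $\mathcal{W}(m)=\{p\in\mathcal{W}:p\mid2^m-1\}$. Put $\Omega_m=\sum_{p\in\mathcal{W}(m)}(A_p-1)\log p$ (empty sum $=0$). For a finite set $S\subseteq\mathcal{W}$, $D(S)=\mathrm{lcm}_{p\in S}d_p$ and $B(S)=\prod_{p\in S}p^{A_p-1}$, with $D(\varnothing)=B(\varnothing)=1$. *)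

(* Defs.v *)
From HB Require Import structures.
From mathcomp Require Import all_boot all_order all_algebra all_fingroup finmap.
From mathcomp Require Import all_classical all_reals all_analysis.

Set Implicit Arguments.
Unset Strict Implicit.
Unset Printing Implicit Defensive.

Import Order.TTheory GRing.Theory Num.Theory.
Import numFieldNormedType.Exports.

Local Open Scope nat_scope.

Definition odd_prime (p : nat) : bool := prime p && odd p.

Definition rad (n : nat) : nat := \prod_(p <- primes n) p.

Definition triple_V (m : nat) : nat * nat * nat := (1, 2 ^ m - 1, 2 ^ m).

(* For an odd prime p, 2 is a unit of 'F_p and d_ p is its order in the group
   of units of 'F_p; the value 0 is only returned when 2 is not a unit. *)
Definition d_ (p : nat) : nat :=
  if insub (2%:R%R : 'F_p) is Some u then #[(u : {unit 'F_p})]%g else 0.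

Definition A_ (p : nat) : nat := logn p (2 ^ d_ p - 1).

Definition wieferich (p : nat) : bool :=
  odd_prime p && (2 ^ (p - 1) == 1 %[mod p ^ 2]).

Definition W_ (m : nat) : {fset nat} :=
  [fset p in primes (2 ^ m - 1) | wieferich p]%fset.

Definition D_ (S : {fset nat}) : nat := \big[lcmn/1]_(p <- S) d_ p.

(* The subtraction is never truncated: 1 <= A_ p for every odd prime p. *)
Definition B_ (S : {fset nat}) : nat := \prod_(p <- S) p ^ (A_ p - 1).

Local Open Scope ring_scope.

Definition E_ (R : realType) (eps : R) (t : nat * nat * nat) : R :=
  let: (a, b, c) := t in
  ln c%:R - (1 + eps) * ln (rad (a * b * c))%:R.

Definition Delta_ (R : realType) (m : nat) : R :=
  ln ((2 ^ m - 1)%N%:R / (rad (2 ^ m - 1))%:R).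

Definition Omega_ (R : realType) (m : nat) : R :=
  \sum_(p <- W_ m) ((A_ p)%:R - 1) * ln p%:R.

Definition theta_ (R : realType) (eps : R) : R := eps / (1 + eps).

(* The limit superior is taken in the extended reals, along the filter of sets
   containing all sufficiently large odd primes. *)
Definition rho_W_pr (R : realType) : \bar R :=
  limf_esup (fun l : nat => (Omega_ R l / (l%:R * ln 2))%:E)
            (within [set l : nat | odd_prime l]%classic \oo%classic).

(* Main.v *)
Require Import Defs.
From HB Require Import structures.
From mathcomp Require Import all_boot all_order all_algebra all_fingroup finmap.
From mathcomp Require Import all_classical all_reals all_analysis.
From mathcomp Require Import cyclic zify lra ring.

(** For an odd prime l, a prime p dividing 2^l - 1 sees 2 as an element whose
order divides l and is not 1; since l is prime that order is l ([d_mersenne]).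
Hence A_p is the exponent of p in 2^l - 1, and the factorisation of 2^l - 1
becomes a statement about the exponents A_p alone.

The link with Wieferich primes is that d_p divides p - 1 with a cofactor prime
to p, so that passing from 2^(d_p) - 1 to 2^(p-1) - 1 does not change the
exponent of p ([logn_mersenne_pred]): p is a Wieferich prime exactly when
A_p > 1 ([wieferichE]).  Non-Wieferich primes therefore divide 2^l - 1 exactly
once, and the excess of 2^l - 1 over its radical is carried by W(l):
    B(W(l)) * rad(2^l - 1) = 2^l - 1    ([mersenne_factor]).
Taking logarithms, Omega_l = log B(W(l)) = Delta_l.

As rad((2^l - 1) 2^l) = 2 rad(2^l - 1), the same factorisation turns the
quality E_eps of the triple into
    (1 + eps) * (Omega_l - log(2 (1 - 2^-l)) - theta_eps l log 2)
([E_tripleE]).  Its sign gives the criterion on B(W(l)), one exponent l at a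
time.  Finally 0 <= log(2 (1 - 2^-l)) <= log 2 is bounded while l log 2 tends
to infinity, so the criterion holds infinitely often for some theta in ]0, 1[
if and only if Omega_l / (l log 2) stays above some positive constant
infinitely often, that is, if and only if its limsup is positive
([infinite_E_ge0P]). *)

Set Implicit Arguments.
Unset Strict Implicit.
Unset Printing Implicit Defensive.

Import Order.TTheory GRing.Theory Num.Theory.
Import numFieldNormedType.Exports.

Local Open Scope classical_set_scope.
Local Open Scope ring_scope.

(** * Orders of 2 and Wieferich primes *)

Local Notation rad := Defs.rad.

Lemma expn2_gt0 m : (0 < 2 ^ m)%N.
Proof. by rewrite expn_gt0. Qed.

Lemma mersenne_gt0 m : (0 < m)%N -> (0 < 2 ^ m - 1)%N.
Proof. by move=> m0; rewrite subn_gt0 -(expn0 2) ltn_exp2l. Qed.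

Lemma odd_mersenne m : (0 < m)%N -> odd (2 ^ m - 1).
Proof. by case: m => // m _; rewrite oddB ?expn2_gt0 // oddX. Qed.

(** The only link to the unit group of 'F_p: from here on, the order of 2 is
handled through the divisibility of natural numbers alone. *)
Lemma d_dvdn p n : odd_prime p -> (d_ p %| n)%N = (p %| 2 ^ n - 1)%N.
Proof.
move=> /andP[pp po].
have two_unit : (2%:R : 'F_p) \is a GRing.unit.
  rewrite unitfE -(dvdn_pcharf (pchar_Fp pp)).
  by rewrite dvdn_prime2 //; apply: contraL po => /eqP->.
rewrite /d_; case: insubP => [u _ uE|]; last by rewrite two_unit.
rewrite order_dvdn -val_eqE FinRing.val_unitX uE /= -natrX.
by rewrite (dvdn_pcharf (pchar_Fp pp)) natrB ?expn2_gt0 // subr_eq0.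
Qed.

Lemma odd_prime_dvd_mersenne p m :
  (0 < m)%N -> prime p -> (p %| 2 ^ m - 1)%N -> odd_prime p.
Proof.
move=> m0 pp pm; rewrite /odd_prime pp /=.
exact: dvdn_odd pm (odd_mersenne m0).
Qed.

Lemma d_dvd_predn p : odd_prime p -> (d_ p %| p - 1)%N.
Proof.
move=> pop; have /andP[pp po] := pop.
rewrite d_dvdn // -eqn_mod_dvd ?expn2_gt0 // subn1 -totient_prime //.
by apply/eqP/Euler_exp_totient; rewrite coprime2n.
Qed.

Lemma d_gt0 p : odd_prime p -> (0 < d_ p)%N.
Proof.
move=> pop; have /andP[pp _] := pop; apply: dvdn_gt0 (d_dvd_predn pop).
by rewrite subn_gt0 prime_gt1.
Qed.

Lemma A_gt0 p : odd_prime p -> (0 < A_ p)%N.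
Proof.
move=> pop; have /andP[pp _] := pop.
rewrite /A_ logn_gt0 mem_primes pp mersenne_gt0 ?d_gt0 //=.
by rewrite -d_dvdn.
Qed.

(** The cofactor 1 + x + ... + x^(k-1) of x - 1 in x^k - 1 is congruent to k
modulo p, hence prime to p. *)
Lemma logn_predX p x k : prime p -> (1 < x)%N -> (0 < k)%N ->
  (p %| x - 1)%N -> coprime p k -> logn p (x ^ k - 1) = logn p (x - 1).
Proof.
move=> pp x1 k0 px pk; rewrite !subn1 predn_exp -subn1.
have x_mod : x = 1 %[mod p] by apply/eqP; rewrite eqn_mod_dvd // ltnW.
set s := (\sum_(i < k) x ^ i)%N.
have s_mod : s = k %[mod p].
  rewrite /s -modn_summ (eq_bigr (fun=> 1 %% p)%N); last first.
    by move=> i _; rewrite -modnXm x_mod modnXm exp1n.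
  by rewrite modn_summ sum1_card card_ord.
have ps : coprime p s by rewrite -coprime_modr s_mod coprime_modr.
have s0 : (0 < s)%N.
  case: posnP ps => // ->; rewrite /coprime gcdn0 => /eqP p1.
  by rewrite p1 in pp.
by rewrite lognM ?subn_gt0 // (logn_coprime ps) addn0.
Qed.

(** The cofactor of d_p in p - 1 is positive and smaller than p, hence prime
to p, so that [logn_predX] applies with x = 2^(d_p). *)
Lemma logn_mersenne_pred p : odd_prime p -> logn p (2 ^ (p - 1) - 1) = A_ p.
Proof.
move=> pop; have /andP[pp _] := pop; have p1 := prime_gt1 pp.
have p10 : (0 < p - 1)%N by rewrite subn_gt0.
have [k kE] := dvdnP (d_dvd_predn pop).
have k0 : (0 < k)%N by case: k kE p10 => // ->.
rewrite kE mulnC expnM /A_ logn_predX //.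
- by rewrite -(expn0 2) ltn_exp2l // d_gt0.
- by rewrite -d_dvdn.
rewrite prime_coprime // gtnNdvd //.
apply: (@leq_ltn_trans (p - 1)); last lia.
by rewrite kE leq_pmulr // d_gt0.
Qed.

Lemma wieferichE p : wieferich p = odd_prime p && (1 < A_ p)%N.
Proof.
rewrite /wieferich; apply: andb_id2l => pop; have /andP[pp _] := pop.
rewrite eqn_mod_dvd ?expn2_gt0 // pfactor_dvdn ?logn_mersenne_pred //.
by rewrite mersenne_gt0 // subn_gt0 prime_gt1.
Qed.

(** * Mersenne numbers with prime exponent *)

Section PrimeExponent.

Variable l : nat.
Hypothesis lP : odd_prime l.

Let l_gt0 : (0 < l)%N.
Proof. by case/andP: lP => /prime_gt0. Qed.

Lemma d_mersenne p : prime p -> (p %| 2 ^ l - 1)%N -> d_ p = l.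
Proof.
move=> pp pl; have pop := odd_prime_dvd_mersenne l_gt0 pp pl.
have /andP[lp _] := lP.
move: pl; rewrite -d_dvdn // => /(prime_nt_dvdP lp); apply.
apply/eqP => d1; have : (d_ p %| 1)%N by rewrite d1.
by rewrite d_dvdn // Euclid_dvd1.
Qed.

Lemma prime_factor_mod p :
  prime p -> (p %| 2 ^ l - 1)%N -> p = 1 %[mod 2 * l].
Proof.
move=> pp pl; have pop := odd_prime_dvd_mersenne l_gt0 pp pl.
have /andP[_ po] := pop; have /andP[_ lo] := lP.
apply/eqP; rewrite eqn_mod_dvd ?prime_gt0 // Gauss_dvd ?coprime2n //.
rewrite -[X in _ && (X %| _)%N](d_mersenne pp pl) d_dvd_predn // andbT.
by rewrite dvdn2 oddB ?prime_gt0 // po.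
Qed.

Lemma mem_W p : p \in W_ l -> wieferich p /\ d_ p = l.
Proof.
rewrite !inE /= => /andP[]; rewrite mem_primes => /and3P[pp _ pl] wp.
by split=> //; apply: d_mersenne.
Qed.

(** An lcm of copies of l; it is l rather than 1 as soon as there is a copy. *)
Lemma D_W : W_ l <> fset0 -> D_ (W_ l) = l.
Proof.
move=> /eqP/fset0Pn[p pW].
have -> : D_ (W_ l) = \big[lcmn/1%N]_(q <- W_ l) l.
  by apply: eq_big_seq => q /mem_W[].
have dvd_l : (\big[lcmn/1%N]_(q <- W_ l) l %| l)%N.
  by elim/big_ind: _ => // m n ml nl; rewrite dvdn_lcm ml.
apply/eqP; rewrite eqn_dvd dvd_l /= (big_fsetD1 p) //=; exact: dvdn_lcml.
Qed.

(** Compare exponents prime by prime: p occurs A_p times in 2^l - 1 and once in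
the radical, and the missing A_p - 1 is zero unless p is in W(l). *)
Lemma mersenne_factor : (B_ (W_ l) * rad (2 ^ l - 1) = 2 ^ l - 1)%N.
Proof.
have N0 := mersenne_gt0 l_gt0.
rewrite [RHS](prod_prime_decomp N0) prime_decompE big_map /= /rad /B_.
have WE : perm_eq (W_ l) [seq p <- primes (2 ^ l - 1) | wieferich p].
  apply: uniq_perm => [||p]; rewrite ?fset_uniq ?filter_uniq ?primes_uniq //.
  by rewrite mem_filter !inE andbC.
rewrite (perm_big _ WE) /= big_filter big_mkcond -big_split /=.
apply: eq_big_seq => p; rewrite mem_primes => /and3P[pp _ pl].
have pop := odd_prime_dvd_mersenne l_gt0 pp pl.
have -> : logn p (2 ^ l - 1) = A_ p by rewrite /A_ d_mersenne.
have A0 := A_gt0 pop.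
case: ifPn => [_|]; first by rewrite -expnSr subn1 prednK.
by rewrite wieferichE pop -leqNgt /= => A1; rewrite (_ : A_ p = 1)%N //; lia.
Qed.

End PrimeExponent.

(** * Radicals *)

Lemma prodn_seq_gt0 (I : eqType) (s : seq I) (F : I -> nat) :
  (forall i, i \in s -> (0 < F i)%N) -> (0 < \prod_(i <- s) F i)%N.
Proof.
move=> F0; rewrite big_seq; elim/big_ind: _ => // m n.
by rewrite muln_gt0 => -> ->.
Qed.

Lemma rad_gt0 n : (0 < rad n)%N.
Proof.
by apply: prodn_seq_gt0 => p; rewrite mem_primes => /and3P[/prime_gt0].
Qed.

Lemma rad_odd_expn2 n k : odd n -> (0 < k)%N -> rad (n * 2 ^ k) = (2 * rad n)%N.
Proof.
move=> no k0; have n0 := odd_gt0 no.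
have two_notin : 2%N \notin primes n by rewrite mem_primes n0 dvdn2 no.
have -> : (2 * rad n = \prod_(p <- 2 :: primes n) p)%N by rewrite big_cons.
apply: perm_big; apply: uniq_perm.
- exact: primes_uniq.
- by rewrite /= two_notin primes_uniq.
by move=> p; rewrite primesM ?expn2_gt0 // primesX // inE orbC inE.
Qed.

(** * Infinite sets and limits superior *)

Lemma infinite_natP (A : set nat) :
  infinite_set A <-> forall n, exists2 m, (n <= m)%N & A m.
Proof.
split=> [Ainf n|Afreq /finite_fsetP[X AX]].
  apply: contrapT => noA; apply: Ainf; apply: sub_finite_set (finite_II n).
  move=> m Am /=; rewrite ltnNge; apply/negP => nm; apply: noA.
  by exists m.
have [m mX] := Afreq (\max_(x <- X) x).+1.
rewrite AX /= => mX'; move: mX; rewrite ltnNge.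
by rewrite (leq_bigmax_seq (F := id) m).
Qed.

Lemma infinite_image_inj (T U : Type) (f : T -> U) (A : set T) :
  injective f -> infinite_set (f @` A) <-> infinite_set A.
Proof.
move=> finj; split; apply: contra_not; first exact: finite_image.
move=> fA.
apply: sub_finite_set (finite_preimage (f := f) _ fA) => [x Ax|x y _ _].
  by exists x.
exact: finj.
Qed.

(** A positive limsup is witnessed by a fixed positive constant reached
infinitely often: this trades extended reals and filters for the infinite sets
in which the rest of the theorem is phrased. *)
Lemma limf_esup_within_gt0P (R : realType) (f : nat -> R) (P : set nat) :
  (0 < limf_esup (fun n => (f n)%:E) (within P \oo))%E <->
  exists2 c : R, 0 < c & infinite_set [set n | P n /\ c <= f n].
Proof.
rewrite limf_esupE; split=> [|[c c0 cinf]]; last first.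
  apply: (@lt_le_trans _ _ c%:E); first by rewrite lte_fin.
  apply/ereal_infP => _ [V [N _ NV] <-].
  have [m Nm [Pm cm]] := (infinite_natP _).1 cinf N.
  apply: (@le_trans _ _ (f m)%:E); first by rewrite lee_fin.
  by apply: ereal_sup_ubound; exists m => //; apply: NV.
set L := ereal_inf _ => L0.
have [c c0 cL] : exists2 c : R, 0 < c & (c%:E < L)%E.
  case: L L0 => [r||] //; last by exists 1; rewrite ?ltry.
  rewrite lte_fin => r0; exists (r / 2); rewrite ?lte_fin; lra.
exists c => //; apply/infinite_natP => n.
pose V := [set m | P m /\ (n <= m)%N].
have VF : within P \oo V by exists n => // m /= nm Pm.
have cV : (c%:E < ereal_sup [set (f m)%:E | m in V])%E.
  by apply: lt_le_trans cL _; apply: ereal_inf_lbound; exists V.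
have [_ [m [Pm nm] <-]] := ereal_sup_gt cV.
by rewrite lte_fin => /ltW cm; exists m.
Qed.

(** * The logarithmic form of the quality *)

Section Logs.

Variable R : realType.
Implicit Type eps : R.

Lemma ln_prodn (I : eqType) (s : seq I) (F : I -> nat) :
  (forall i, i \in s -> (0 < F i)%N) ->
  ln (\prod_(i <- s) F i)%:R = \sum_(i <- s) ln (F i)%:R :> R.
Proof.
elim: s => [|i s IH] F0; first by rewrite !big_nil ln1.
have F0s j : j \in s -> (0 < F j)%N by move=> js; rewrite F0 // inE js orbT.
rewrite !big_cons natrM lnM ?IH // posrE ltr0n ?prodn_seq_gt0 //.
by rewrite F0 // mem_head.
Qed.

Lemma ln2_gt0 : 0 < ln 2 :> R.
Proof. by rewrite ln_gt0 // ltr1n. Qed.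

Section PrimeExponent.

Variable l : nat.
Hypothesis lP : odd_prime l.

Let l_gt0 : (0 < l)%N.
Proof. by case/andP: lP => /prime_gt0. Qed.

Lemma B_gt0 : (0 < B_ (W_ l))%N.
Proof.
have := mersenne_gt0 l_gt0; rewrite -(mersenne_factor lP) muln_gt0.
by case/andP.
Qed.

Lemma OmegaE : Omega_ R l = ln (B_ (W_ l))%:R.
Proof.
have W_odd p : p \in W_ l -> odd_prime p.
  by move=> /(mem_W lP)[]; rewrite wieferichE => /andP[].
have W_gt0 p : p \in W_ l -> (0 < p)%N.
  by move=> /W_odd/andP[/prime_gt0].
rewrite /Omega_ /B_ ln_prodn => [|p /W_gt0 p0]; last by rewrite expn_gt0 p0.
apply: eq_big_seq => p pW; rewrite natrX lnXn ?ltr0n ?W_gt0 //.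
by rewrite -[RHS]mulr_natl natrB ?A_gt0 ?W_odd.
Qed.

Lemma DeltaE : Delta_ R l = Omega_ R l.
Proof.
rewrite OmegaE /Delta_ -[in X in X%:R / _](mersenne_factor lP) natrM.
by rewrite mulfK // pnatr_eq0 -lt0n rad_gt0.
Qed.

Let expN2_le_half : 2 ^- l <= 2^-1 :> R.
Proof.
rewrite lef_pV2 ?posrE ?exprn_gt0 // -{1}[2]expr1 ler_eXn2l //.
by rewrite ltr1n.
Qed.

(** Eliminate log rad(2^l - 1) between the definition of E and the logarithm of
the factorisation B(W(l)) * rad(2^l - 1) = 2^l (1 - 2^-l). *)
Lemma E_tripleE eps : 0 < eps ->
  E_ eps (triple_V l) = (1 + eps) *
    (Omega_ R l - (ln (2 * (1 - 2 ^- l)) + theta_ eps * l%:R * ln 2)).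
Proof.
move=> eps0.
have r0 : 0 < (rad (2 ^ l - 1))%:R :> R by rewrite ltr0n rad_gt0.
have B0 : 0 < (B_ (W_ l))%:R :> R by rewrite ltr0n B_gt0.
have u0 : 0 < 1 - 2 ^- l :> R by have := expN2_le_half; lra.
have N_ln : ln (1 - 2 ^- l) + l%:R * ln 2 =
    Omega_ R l + ln (rad (2 ^ l - 1))%:R.
  rewrite OmegaE -lnM ?posrE // -natrM (mersenne_factor lP).
  rewrite mulr_natl -lnXn // -lnM ?posrE ?exprn_gt0 //.
  have p0 : 2 ^+ l != 0 :> R by rewrite lt0r_neq0 ?exprn_gt0.
  by rewrite natrB ?expn2_gt0 // natrX mulrBl mul1r mulVf.
rewrite /E_ /triple_V mul1n rad_odd_expn2 ?odd_mersenne //.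
rewrite natrX lnXn // natrM !lnM ?posrE // -[ln 2 *+ l]mulr_natl /theta_.
have -> : ln (rad (2 ^ l - 1))%:R =
  ln (1 - 2 ^- l) + l%:R * ln 2 - Omega_ R l by rewrite N_ln; ring.
by field; lra.
Qed.

Lemma E_ge0E eps : 0 < eps ->
  (0 <= E_ eps (triple_V l)) =
  (ln (2 * (1 - 2 ^- l)) + theta_ eps * l%:R * ln 2 <= Omega_ R l).
Proof. by move=> eps0; rewrite E_tripleE // pmulr_rge0 ?subr_ge0 //; lra. Qed.

Lemma E_ge0_B eps : 0 < eps ->
  (0 <= E_ eps (triple_V l)) =
  ((2 * (1 - 2 ^- l)) * 2 `^ (theta_ eps * l%:R) <= (B_ (W_ l))%:R).
Proof.
move=> eps0; rewrite E_ge0E // OmegaE.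
have u0 : 0 < 2 * (1 - 2 ^- l) :> R by have := expN2_le_half; lra.
have p0 : 0 < 2 `^ (theta_ eps * l%:R) :> R by rewrite powR_gt0.
by rewrite -ln_powR -lnM ?ler_ln ?posrE ?ltr0n ?B_gt0 // mulr_gt0.
Qed.

(** Both bounds serve to neglect this term against l log 2: the lower one when
a lower bound on Omega is deduced, the upper one when E >= 0 is deduced. *)
Lemma ln_defect_bounds : 0 <= ln (2 * (1 - 2 ^- l) : R) <= ln 2.
Proof.
have := expN2_le_half; have : 0 < 2 ^- l :> R by rewrite invr_gt0 exprn_gt0.
move=> v0 v1; rewrite ln_ge0 ?ler_ln ?posrE; lra.
Qed.

End PrimeExponent.

(** * Infinitely many good triples *)

Lemma infinite_triples eps :
  infinite_set [set t : nat * nat * nat |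
    exists2 l : nat, odd_prime l & t = triple_V l /\ 0 <= E_ eps t] <->
  infinite_set [set l : nat | odd_prime l /\ 0 <= E_ eps (triple_V l)].
Proof.
have triple_inj : injective triple_V.
  by move=> m n [_ /eqP]; rewrite eqn_exp2l // => /eqP.
rewrite -[X in _ <-> X](infinite_image_inj _ triple_inj).
rewrite (_ : [set t | _] =
  triple_V @` [set l | odd_prime l /\ 0 <= E_ eps (triple_V l)]) //.
apply/seteqP; split=> [t [l lP [-> E0]]|_ [l [lP E0] <-]]; by exists l.
Qed.

(** If E_eps >= 0 infinitely often, then Omega_l / (l log 2) >= theta_eps
infinitely often.  Conversely, if this ratio is at least c > 0 infinitely
often, half of c is spent on theta_eps and the other half absorbs the bounded
term log(2 (1 - 2^-l)) once l >= 2 / c. *)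
Lemma infinite_E_ge0P :
  (exists2 eps : R, 0 < eps &
    infinite_set [set l : nat | odd_prime l /\ 0 <= E_ eps (triple_V l)]) <->
  (0 < rho_W_pr R)%E.
Proof.
have ln20 := ln2_gt0.
rewrite /rho_W_pr limf_esup_within_gt0P; split=> -[c c0].
  move=> Einf; exists (theta_ c); first by rewrite divr_gt0 //; lra.
  apply: sub_infinite_set Einf => l /= [lP E0]; split=> //.
  have /andP[/prime_gt0 l0 _] := lP.
  rewrite ler_pdivlMr ?mulr_gt0 ?ltr0n // mulrA.
  move: E0; rewrite E_ge0E //; have := ln_defect_bounds lP; lra.
move=> Oinf.
(* The map eps |-> theta_eps is onto ]0, 1[ with inverse
   theta |-> theta / (1 - theta); the minimum keeps theta below 1. *)
pose theta := Num.min (c / 2) 2^-1.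
have theta0 : 0 < theta by rewrite lt_min; apply/andP; split; lra.
have theta_c : theta <= c / 2 by rewrite ge_min lexx.
have theta_1 : theta <= 2^-1 by rewrite ge_min lexx orbT.
have eps0 : 0 < theta / (1 - theta) by rewrite divr_gt0 //; lra.
exists (theta / (1 - theta)) => //.
have thetaE : theta_ (theta / (1 - theta)) = theta.
  rewrite /theta_; field; apply/andP; split; lra.
apply/infinite_natP => n.
have [m nm [mP cm]] := (infinite_natP _).1 Oinf
  (maxn n (Num.bound (2 / c))).
exists m; first by apply: leq_trans nm; rewrite leq_maxl.
split=> //; rewrite E_ge0E // thetaE.
have /andP[/prime_gt0 m0 _] := mP.
have m_large : 2 / c <= m%:R.
  apply: ltW; apply: lt_le_trans (archi_boundP _) _.
    by rewrite divr_ge0 ?ltW.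
  by rewrite ler_nat; apply: leq_trans nm; rewrite leq_maxr.
rewrite ler_pdivrMr // in m_large.
rewrite ler_pdivlMr ?mulr_gt0 ?ltr0n // mulrA in cm.
have /andP[_ defect] := ln_defect_bounds mP.
apply: le_trans (lerD defect (lexx _)) _; apply: le_trans cm.
rewrite -{1}[ln 2]mul1r -mulrDl (ler_wpM2r (ltW ln20)) //.
have : theta * m%:R <= c / 2 * m%:R by rewrite ler_wpM2r.
lra.
Qed.

End Logs.

Theorem theorem6p26 (R : realType) :
  (forall l : nat, odd_prime l ->
     (forall p : nat, prime p -> (p %| 2 ^ l - 1)%N ->
        d_ p = l /\ p = 1 %[mod 2 * l])
     /\ Delta_ R l = Omega_ R l
     /\ (W_ l <> fset0 -> D_ (W_ l) = l))
  /\
  (forall eps : R, 0 < eps ->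
     (infinite_set [set t : nat * nat * nat |
        exists2 l : nat, odd_prime l & t = triple_V l /\ 0 <= E_ eps t]
      <->
      infinite_set [set l : nat | odd_prime l /\
        (2 * (1 - 2 ^- l)) * 2 `^ (theta_ eps * l%:R) <= (B_ (W_ l))%:R :> R]))
  /\
  ((exists2 eps : R, 0 < eps &
      infinite_set [set t : nat * nat * nat |
        exists2 l : nat, odd_prime l & t = triple_V l /\ 0 <= E_ eps t])
   <-> (0 < rho_W_pr R)%E).
Proof.
split=> [l lP|].
  split=> [p pp pl|].
    by split; [exact: d_mersenne | exact: prime_factor_mod].
  by split; [exact: DeltaE|exact: D_W].
split=> [eps eps0|].
  rewrite infinite_triples.
  rewrite (_ : [set l | odd_prime l /\ 0 <= _] =
    [set l : nat | odd_prime l /\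
      (2 * (1 - 2 ^- l)) * 2 `^ (theta_ eps * l%:R) <= (B_ (W_ l))%:R]) //.
  by apply/seteqP; split=> l /= [lP]; rewrite E_ge0_B.
rewrite -infinite_E_ge0P.
by split=> -[eps eps0 /infinite_triples Einf]; exists eps.
Qed.
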